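(* Let $1\le p<\infty$, let $(\mathbb{X},\|\cdot\|)$ be a Banach space, and consider the equation $x'(t)=A(t)x(t)+f(t,x(t))$, $t\in\mathbb{R}$, where $\{A(t)\}_{t\in\mathbb{R}}$ is a family of closed densely defined linear operators $A(t):D(A(t))\subset\mathbb{X}\to\mathbb{X}$ satisfying the Acquistapace–Terreni conditions, with evolution family $\{\mathcal{U}(t,s)\}_{t\ge s}$. Assume: (1) there exist constants $K\ge 1$, $\lambda>0$ such that $\|\mathcal{U}(t,s)\|\le Ke^{-\lambda(t-s)}$ for all $t\ge s$; (2) $\{\mathcal{U}(t,s)\}_{t\ge s}$ is bi-almost automorphic; (3) $f\in W^p_{AA}(\mathbb{R}\times\mathbb{X},\mathbb{X})$ and there are positive constants $L_f,M_f$ such that $\|f(t,x)-f(t,y)\|\le L_f\|x-y\|$ and $\|f(t,x)\|\le M_f(1+\|x\|)$ for all $x,y\in\mathbb{X}$, $t\in\mathbb{R}$; (4) $\Theta:=\frac{KL_f}{\lambda}<1$. Then the unique $p$-th Weyl almost automorphic mild solution of the equation (in $W^p_{AA}(\mathbb{R},\mathbb{X})\cap\mathcal{L}^\infty(\mathbb{R},\mathbb{X})$) is globally exponentially stable.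
   Context: $\mathcal{L}^p_{loc}(\mathbb{R},\mathbb{X})$ is the set of functions $\mathbb{R}\to\mathbb{X}$ that are $p$-integrable on every compact interval; $\mathcal{L}^\infty(\mathbb{R},\mathbb{X})$ is the space of measurable essentially bounded functions with norm $\|g\|_\infty=\operatorname{ess\,sup}_t\|g(t)\|$. The Weyl seminorm of $u\in\mathcal{L}^p_{loc}(\mathbb{R},\mathbb{X})$ is $$\|u\|_{W^p}=\lim_{h\to\infty}\sup_{\theta\in\mathbb{R}}\Big(\frac1h\int_\theta^{\theta+h}\|u(s)\|^p\,ds\Big)^{1/p},$$ and $W^p_B(\mathbb{R},\mathbb{X})$ is the set of $u\in\mathcal{L}^p_{loc}(\mathbb{R},\mathbb{X})$ with $\|u\|_{W^p}<\infty$. $W^p_{AA}(\mathbb{R},\mathbb{X})$ ($p$-th Weyl almost automorphic functions): all $\varphi\in W^p_B(\mathbb{R},\mathbb{X})$ such that every real sequence $\{\gamma'_n\}$ has a subsequence $\{\gamma_n\}$ for which there is a function $\tilde\varphi:\mathbb{R}\to\mathbb{X}$ with $\lim_n\|\varphi(\cdot+\gamma_n)-\tilde\varphi(\cdot)\|_{W^p}=0$ and $\lim_n\|\tilde\varphi(\cdot-\gamma_n)-\varphi(\cdot)\|_{W^p}=0$. $W^p_{AA}(\mathbb{R}\times\mathbb{X},\mathbb{Y})$ ($\mathbb{Y}$ a Banach space): all $f:\mathbb{R}\times\mathbb{X}\to\mathbb{Y}$ with $f(\cdot,x)\in W^p_B(\mathbb{R},\mathbb{Y})$ for each $x\in\mathbb{X}$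 such that for every bounded $\mathbb{B}\subset\mathbb{X}$ and every real sequence $\{\gamma'_n\}$ there are a subsequence $\{\gamma_n\}$ and $\tilde f:\mathbb{R}\times\mathbb{X}\to\mathbb{Y}$ with $\lim_n\|f(\cdot+\gamma_n,x)-\tilde f(\cdot,x)\|_{W^p}=0$ and $\lim_n\|\tilde f(\cdot-\gamma_n,x)-f(\cdot,x)\|_{W^p}=0$ uniformly in $x\in\mathbb{B}$. Acquistapace–Terreni conditions. Write $R(\lambda,L)=(\lambda I-L)^{-1}$ for $\lambda$ in the resolvent set $\rho(L)$ and $\Sigma_\theta=\{\lambda\in\mathbb{C}\setminus\{0\}:|\arg\lambda|\le\theta\}$. (S1) There are $\lambda_0\ge0$, $\theta\in(\frac\pi2,\pi)$, $K_1\ge0$ such that $\Sigma_\theta\cup\{0\}\subset\rho(A(t)-\lambda_0)$ and $\|R(\lambda,A(t)-\lambda_0)\|\le\frac{K_1}{1+|\lambda|}$ for all $\lambda\in\Sigma_\theta\cup\{0\}$, $t\in\mathbb{R}$. (S2) There are $K_2\ge0$ and $\alpha,\beta\in(0,1]$ with $\alpha+\beta>1$ such that $\|(A(t)-\lambda_0)R(\lambda,A(t)-\lambda_0)[R(\lambda_0,A(t))-R(\lambda_0,A(s))]\|\le\frac{K_2|t-s|^\alpha}{|\lambda|^\beta}$ for all $\lambda\in\Sigma_\theta$, $t,s\in\mathbb{R}$. Under (S1), (S2) the family $A(t)$ generates a unique evolution family $\{\mathcal{U}(t,s)\}_{t\ge s}$ of bounded operators on $\mathbb{X}$ with $\mathcal{U}(t,s)\mathbb{X}\subset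 D(A(t))$ for $t>s$ and: (i) $\mathcal{U}(t,r)\mathcal{U}(r,s)=\mathcal{U}(t,s)$, $\mathcal{U}(s,s)=I$ for $t\ge r\ge s$; (ii) $(t,s)\mapsto\mathcal{U}(t,s)x$ is continuous for $t\ge s$, each $x\in\mathbb{X}$; (iii) $\mathcal{U}(\cdot,s)\in C^1((s,\infty),L(\mathbb{X}))$, $\frac{\partial\mathcal{U}}{\partial t}(t,s)=A(t)\mathcal{U}(t,s)$, and $\|A(t)^j\mathcal{U}(t,s)\|\le C(t-s)^{-j}$ for $0<t-s<1$, $j=0,1$, with a constant $C$. Bi-almost automorphic: every real sequence $\{\gamma_n'\}$ has a subsequence $\{\gamma_n\}$ such that for each pair $t\ge s$ the limit $\tilde{\mathcal{U}}(t,s):=\lim_n\mathcal{U}(t+\gamma_n,s+\gamma_n)$ exists and $\lim_n\tilde{\mathcal{U}}(t-\gamma_n,s-\gamma_n)=\mathcal{U}(t,s)$, limits being in the operator norm of $L(\mathbb{X})$. Mild solution: a function $x\in\mathcal{L}^\infty(\mathbb{R},\mathbb{X})$ with $x(t)=\mathcal{U}(t,s)x(s)+\int_s^t\mathcal{U}(t,r)f(r,x(r))\,dr$ for all $t\ge s$, $s\in\mathbb{R}$. Global exponential stability of a solution $x^*$: there are positive numbers $N$ and $\kappa$ such that for every $t_0\in\mathbb{R}$ and every solution $x$ with initial value $x(t_0)$ at $t_0$, i.e. every continuous $x:[t_0,\infty)\to\mathbb{X}$ with $x(t)=\mathcal{U}(t,t_0)x(t_0)+\int_{t_0}^t\mathcal{U}(t,r)f(r,x(r))\,dr$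 for $t\ge t_0$, one has $\|x(t)-x^*(t)\|\le N\|x(t_0)-x^*(t_0)\|e^{-\kappa(t-t_0)}$ for all $t>t_0$.
   Formalization: Existence of a Weyl almost automorphic mild solution, which can fail under the stated hypotheses in infinite dimensions, is assumed: any such solution is proved to be the only one and to be globally exponentially stable. *)

(* Defs.v *)
From HB Require Import structures.
From mathcomp Require Import all_boot all_order all_algebra.
From mathcomp Require Export complex.
From mathcomp Require Import all_classical all_reals all_analysis.
From mathcomp Require Import ess_sup_inf.

Set Implicit Arguments.
Unset Strict Implicit.
Unset Printing Implicit Defensive.

Import Order.TTheory GRing.Theory Num.Theory.
Import numFieldNormedType.Exports.

Local Open Scope classical_set_scope.
Local Open Scope ring_scope.
Local Open Scope complex_scope.

(* The Acquistapace-Terreni conditions involve complex resolvent parameters, so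
   Banach spaces are over R[i].  The library norm then takes values in R[i]
   (with zero imaginary part); [nrm] is the same norm as a real number.  On
   R[i] itself it is the modulus. *)
Definition nrm (R : realType) (V : normedZmodType R[i]) (x : V) : R :=
  complex.Re `|x|.

Section bochner.
Context {R : realType} {X : completeNormedModType R[i]}.
Local Notation mu := (@lebesgue_measure R).

(* A simple function is presented as a finite sum of values carried by
   measurable, not necessarily disjoint, sets. *)
Record simple_function := SimpleFunction {
  sf_size : nat ;
  sf_set : 'I_sf_size -> set R ;
  sf_val : 'I_sf_size -> X ;
  sf_measurable : forall i, measurable (sf_set i : set (measurableTypeR R))
}.

Definition sf_eval (g : simple_function) (t : R) : X :=
  \sum_(i < sf_size g) (\1_(sf_set i) t : R[i]) *: sf_val i.

Definition sf_integral (a b : R) (g : simple_function) : X :=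
  \sum_(i < sf_size g) (fine (mu (sf_set i `&` `[a, b])))%:C *: sf_val i.

(* Simple functions are Borel, but convergence is only required almost
   everywhere, so this is Bochner (strong) measurability with respect to the
   Lebesgue sigma-algebra.  The library integral of a nonnegative function is a
   supremum over Borel simple functions below it, hence it is the Lebesgue
   integral also for Lebesgue-measurable integrands. *)
Definition strongly_measurable (D : set R) (u : R -> X) : Prop :=
  exists g : nat -> simple_function,
    {ae mu, forall t, D t -> sf_eval (g n) t @[n --> \oo] --> u t}.

(* u is Bochner integrable on [a, b], with integral v *)
Definition is_bochner_integral (a b : R) (u : R -> X) (v : X) : Prop :=
  strongly_measurable `[a, b] u /\
  exists g : nat -> simple_function,
    (\int[mu]_(t in `[a, b]) (nrm (u t - sf_eval (g n) t))%:E)%E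
      @[n --> \oo] --> 0%E /\
    sf_integral a b (g n) @[n --> \oo] --> v.

Definition Lp_loc (p : R) (u : R -> X) : Prop :=
  strongly_measurable setT u /\
  forall a b : R, (\int[mu]_(t in `[a, b]) (nrm (u t) `^ p)%:E < +oo)%E.

Definition L_infty (u : R -> X) : Prop :=
  strongly_measurable setT u /\
  (ess_sup mu (fun t => (nrm (u t))%:E) < +oo)%E.

End bochner.

Section weyl.
Context {R : realType}.
Local Notation mu := (@lebesgue_measure R).

Section functions_of_time.
Context {X : completeNormedModType R[i]}.
Implicit Types (p h : R) (u phi psi : R -> X).

Definition weyl_mean p u h : \bar R :=
  ereal_sup [set ((h^-1)%:E *
    \int[mu]_(s in `[theta, (theta + h)%R]) (nrm (u s) `^ p)%:E) `^ p^-1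
    | theta in [set: R]]%E.

Definition weyl_norm p u : \bar R := lim (weyl_mean p u h @[h --> +oo]).

Definition W_B p u : Prop := Lp_loc p u /\ (weyl_norm p u < +oo)%E.

(* The limit function [psi] has to be locally p-integrable for the seminorms
   of the differences to be meaningful. *)
Definition W_AA p phi : Prop :=
  W_B p phi /\
  forall gamma' : nat -> R, exists k : nat -> nat,
    {homo k : m n / (m < n)%N} /\
    let gamma := gamma' \o k in
    exists psi : R -> X,
      [/\ Lp_loc p psi,
          weyl_norm p (fun t => phi (t + gamma n) - psi t)
            @[n --> \oo] --> 0%E &
          weyl_norm p (fun t => psi (t - gamma n) - phi t)
            @[n --> \oo] --> 0%E].

End functions_of_time.

Definition W_AA2 {X Y : completeNormedModType R[i]} (p : R)
    (f : R -> X -> Y) : Prop :=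
  (forall x, W_B p (f ^~ x)) /\
  forall (B : set X), bounded_set B ->
  forall gamma' : nat -> R, exists k : nat -> nat,
    {homo k : m n / (m < n)%N} /\
    let gamma := gamma' \o k in
    exists g : R -> X -> Y,
      [/\ forall x, Lp_loc p (g ^~ x),
          forall e : R, 0 < e -> \forall n \near \oo, forall x, B x ->
            (weyl_norm p (fun t => f (t + gamma n) x - g t x)%R < e%:E)%E &
          forall e : R, 0 < e -> \forall n \near \oo, forall x, B x ->
            (weyl_norm p (fun t => g (t - gamma n) x - f t x)%R < e%:E)%E].

End weyl.

Section operators.
Context {R : realType} {X : completeNormedModType R[i]}.

(* The operator norm, +oo for unbounded maps. *)
Definition opnorm (T : X -> X) : \bar R :=
  ereal_sup [set (nrm (T x))%:E | x in [set x | nrm x <= 1]].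

Definition bounded_op (T : X -> X) : Prop := linear T /\ (opnorm T < +oo)%E.

(* A partially defined operator; the values of [op_fun] outside [op_dom] are
   irrelevant. *)
Record partial_op := PartialOp { op_dom : set X ; op_fun :> X -> X }.

Definition linear_op (L : partial_op) : Prop :=
  op_dom L 0 /\
  forall (a : R[i]) (x y : X), op_dom L x -> op_dom L y ->
    op_dom L (a *: x + y) /\ L (a *: x + y) = a *: L x + L y.

Definition closed_op (L : partial_op) : Prop :=
  closed [set q : X * X | op_dom L q.1 /\ q.2 = L q.1].

Definition densely_defined (L : partial_op) : Prop := dense (op_dom L).

Definition op_shift (L : partial_op) (c : R[i]) : partial_op :=
  PartialOp (op_dom L) (fun x => L x - c *: x).

(* R(lambda, L) x is the y in D(L) with (lambda I - L) y = x. *)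
Definition resolvent (lambda : R[i]) (L : partial_op) (x : X) : X :=
  xget 0 [set y | op_dom L y /\ lambda *: y - L y = x].

Definition resolvent_set (L : partial_op) : set R[i] :=
  [set lambda | (forall x, exists! y, op_dom L y /\ lambda *: y - L y = x) /\
                (opnorm (resolvent lambda L) < +oo)%E].

(* principal argument, in ]-pi, pi] *)
Definition carg (z : R[i]) : R :=
  xget 0 [set phi | - pi < phi <= pi /\
                    z = (nrm z * cos phi) +i* (nrm z * sin phi)].

Definition sector (theta : R) : set R[i] :=
  [set z | z != 0 /\ `|carg z| <= theta].

Definition acquistapace_terreni (A : R -> partial_op) : Prop :=
  exists lambda0 theta K1 : R,
  [/\ 0 <= lambda0, pi / 2 < theta < pi, 0 <= K1,
      forall (lambda : R[i]) (t : R), (sector theta `|` [set 0]) lambda ->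
        resolvent_set (op_shift (A t) lambda0%:C) lambda /\
        (opnorm (resolvent lambda (op_shift (A t) lambda0%:C))
           <= (K1 / (1 + nrm lambda))%:E)%E &
      exists K2 alpha beta : R,
      [/\ 0 <= K2, 0 < alpha <= 1, 0 < beta <= 1, 1 < alpha + beta &
          forall (lambda : R[i]) (t s : R), sector theta lambda ->
            (opnorm (fun x =>
               op_shift (A t) lambda0%:C
                 (resolvent lambda (op_shift (A t) lambda0%:C)
                   (resolvent lambda0%:C (A t) x
                    - resolvent lambda0%:C (A s) x))%R)
             <= (K2 * `|t - s| `^ alpha / nrm lambda `^ beta)%:E)%E]].

(* U is the evolution family generated by A; only U t s with s <= t matters. *)
Definition evolution_family (A : R -> partial_op) (U : R -> R -> X -> X) :
    Prop :=
  [/\ (forall t s, s <= t -> bounded_op (U t s)) /\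
      (forall t s x, s < t -> op_dom (A t) (U t s x)),
      (forall t r s x, s <= r -> r <= t -> U t r (U r s x) = U t s x) /\
      (forall s x, U s s x = x),
      forall x, {within [set q : R * R | q.2 <= q.1],
                   continuous (fun q : R * R => U q.1 q.2 x)},
      forall s t, s < t ->
        [/\ bounded_op (fun x => A t (U t s x)),
            opnorm (fun x => (h^-1)%:C *: (U (t + h) s x - U t s x)
                             - A t (U t s x)) @[h --> 0^'] --> 0%E &
            opnorm (fun x => A r (U r s x) - A t (U t s x))
              @[r --> t] --> 0%E] &
      exists C : R, forall t s, 0 < t - s < 1 ->
        (opnorm (U t s) <= C%:E)%E /\
        (opnorm (fun x => A t (U t s x)) <= (C / (t - s))%:E)%E].

Definition bi_almost_automorphic (U : R -> R -> X -> X) : Prop :=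
  forall gamma' : nat -> R, exists k : nat -> nat,
    {homo k : m n / (m < n)%N} /\
    let gamma := gamma' \o k in
    exists V : R -> R -> X -> X, forall t s, s <= t ->
      [/\ bounded_op (V t s),
          opnorm (fun x => U (t + gamma n) (s + gamma n) x - V t s x)
            @[n --> \oo] --> 0%E &
          opnorm (fun x => V (t - gamma n) (s - gamma n) x - U t s x)
            @[n --> \oo] --> 0%E].

(* x(t) = U(t,s) x(s) + \int_s^t U(t,r) f(r, x(r)) dr *)
Definition duhamel (U : R -> R -> X -> X) (f : R -> X -> X) (x : R -> X)
    (t s : R) : Prop :=
  exists2 v, is_bochner_integral s t (fun r => U t r (f r (x r))) v &
             x t = U t s (x s) + v.

Definition mild_solution (U : R -> R -> X -> X) (f : R -> X -> X)
    (x : R -> X) : Prop :=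
  L_infty x /\ forall t s, s <= t -> duhamel U f x t s.

Definition globally_exponentially_stable (U : R -> R -> X -> X)
    (f : R -> X -> X) (xs : R -> X) : Prop :=
  exists N kappa : R, [/\ 0 < N, 0 < kappa &
    forall (t0 : R) (x : R -> X),
      {within `[t0, +oo[, continuous x} ->
      (forall t, t0 <= t -> duhamel U f x t t0) ->
      forall t, t0 < t ->
        nrm (x t - xs t) <= N * nrm (x t0 - xs t0) * expR (- kappa * (t - t0))].

End operators.

(* Main.v *)
Require Import Defs.
From HB Require Import structures.
From mathcomp Require Import all_boot all_order all_algebra.
From mathcomp Require Import complex ring lra.
From mathcomp Require Import all_classical all_reals all_analysis.
From mathcomp Require Import measurable_realfun ess_sup_inf.

(** Two functions x and y solving the Duhamel formula from the same time t0 have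
    a difference w(t) = ||x(t) - y(t)|| with
      w(t) <= K e^(-lambda (t - t0)) w(t0)
              + \int_t0^t K Lf e^(-lambda (t - r)) w(r) dr.
    Fix a rate kappa > 0 with K Lf < lambda - kappa, which the hypothesis
    K Lf < lambda permits, and let m be the supremum of w(r) e^(kappa (r - t0))
    over [t0, t].  Inserting w(r) <= m e^(-kappa (r - t0)) under the integral
    gives m <= K w(t0) + q m with q = K Lf / (lambda - kappa) < 1, hence
      w(t) <= K / (1 - q) w(t0) e^(-kappa (t - t0)).
    This weighted contraction ([duhamel_dist_le], [duhamel_dist_expR]) plays
    the role of the Gronwall inequality.  It only integrates an explicit
    exponential, so w may be any locally bounded function, without
    measurability.

    Stability is this estimate for y := xs.  Local boundedness of w holds
    because x is continuous and because xs is bounded at every point, not only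
    almost everywhere: in the Duhamel formula the integral term sees xs only up
    to a null set, and the initial time can be chosen in every interval so that
    xs there obeys the essential bound ([mild_solution_bounded]).  Uniqueness
    follows by letting t0 tend to -oo in the same estimate: w(t0) stays bounded
    while the exponential factor tends to 0.

    The remaining work is to bound the norm of a difference of two Bochner
    integrals by the integral of a bound of the integrands
    ([bochner_dist_le]).  It is proved for simple functions and passed to the
    limit. *)

Set Implicit Arguments.
Unset Strict Implicit.
Unset Printing Implicit Defensive.

Import Order.TTheory GRing.Theory Num.Theory.
Import numFieldNormedType.Exports.

Local Open Scope classical_set_scope.
Local Open Scope ring_scope.


(** * The real-valued norm of a complex normed space *)
Section norm.
Context {R : realType} {V : normedZmodType R[i]}.
Implicit Types x y : V.

Lemma nrmE x : `|x| = ((nrm x)%:C)%C.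
Proof. by rewrite /nrm RRe_real// ger0_real. Qed.

Lemma nrm_ge0 x : 0 <= nrm x.
Proof. by rewrite -ler0c -nrmE. Qed.

Lemma nrm0 : nrm (0 : V) = 0.
Proof. by rewrite /nrm normr0. Qed.

Lemma nrm_eq0 x : nrm x = 0 -> x = 0.
Proof. by move=> x0; apply/normr0_eq0; rewrite nrmE x0. Qed.

Lemma nrmN x : nrm (- x) = nrm x.
Proof. by rewrite /nrm normrN. Qed.

Lemma nrmD x y : nrm (x + y) <= nrm x + nrm y.
Proof. by rewrite -lecR rmorphD/= -!nrmE ler_normD. Qed.

Lemma nrmB x y : nrm (x - y) <= nrm x + nrm y.
Proof. by rewrite (le_trans (nrmD _ _))// nrmN. Qed.

Lemma nrm_distC x y : nrm (x - y) = nrm (y - x).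
Proof. by rewrite /nrm distrC. Qed.

Lemma nrm_dist_dist x y : `|nrm x - nrm y| <= nrm (x - y).
Proof.
have := nrmD (x - y) y; have := nrmD (y - x) x; rewrite !subrK nrm_distC => yx xy.
by rewrite ler_norml; lra.
Qed.

End norm.

Section normed_module.
Context {R : realType} {X : normedModType R[i]}.
Implicit Types x y : X.

Lemma nrmZ (k : R) x : nrm ((k%:C)%C *: x) = `|k| * nrm x.
Proof.
by apply: complexI; rewrite rmorphM/= -!nrmE normrZ normc_def/= expr0n/= addr0 sqrtr_sqr nrmE.
Qed.

Lemma cvg_nrm T (F : set_system T) {FF : Filter F} (u : T -> X) x :
  u @ F --> x -> (fun t => nrm (u t)) @ F --> nrm x.
Proof.
move=> /cvgrPdist_lt ux; apply/cvgrPdist_lt => e e0.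
have /ux : 0 < (e%:C)%C by rewrite ltcR.
apply: filterS => t; rewrite nrmE ltcR.
exact: le_lt_trans (nrm_dist_dist _ _).
Qed.

End normed_module.

(** * Monotonicity of the integral without measurability *)
Section integral.
Context d (T : measurableType d) (R : realType) (mu : {measure set T -> \bar R}).

(** The integral of a nonnegative function is a supremum over the simple
    functions below it, so it is monotone even for functions that are not Borel
    measurable, such as the norm of a strongly measurable function. *)
Lemma ge0_le_lower_integral (D E : set T) (f g : T -> \bar R) : D `<=` E ->
  (forall t, 0 <= f t)%E -> (forall t, 0 <= g t)%E -> (forall t, D t -> f t <= g t)%E ->
  (\int[mu]_(t in D) f t <= \int[mu]_(t in E) g t)%E.
Proof.
move=> DE f0 g0 fg; rewrite !ge0_integralE//.
apply: ereal_sup_le => _ [h hf <-]; exists h => //.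
move=> t; rewrite (le_trans (hf t))// !patchE.
case: ifPn => [/set_mem Dt|_]; first by rewrite (mem_set (DE _ Dt)) fg.
by case: ifP.
Qed.
End integral.

(** * The triangle inequality for integrals of simple functions *)
Section simple.
Context {R : realType} {X : completeNormedModType R[i]}.
Local Notation mu := (@lebesgue_measure R).

(** The constant [c] makes the induction on the number of sets go through: on the
    part of the domain inside the first set, its value is absorbed in [c]. *)
Definition step n (A : 'I_n -> set R) (v : 'I_n -> X) (c : X) (t : R) : X :=
  c + \sum_(i < n) (\1_(A i) t : R[i]) *: v i.

Lemma stepS n (A : 'I_n.+1 -> set R) (v : 'I_n.+1 -> X) c t :
  step A v c t =
  step (fun i => A (lift ord0 i)) (fun i => v (lift ord0 i))
    (if t \in A ord0 then c + v ord0 else c) t.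
Proof.
rewrite /step big_ord_recl addrA; congr (_ + _).
by rewrite indicE; case: ifP => _; rewrite ?scale1r ?scale0r ?addr0.
Qed.

Lemma measurable_nrm_step n (A : 'I_n -> set R) (v : 'I_n -> X) c :
  (forall i, measurable (A i : set (measurableTypeR R))) ->
  measurable_fun setT (fun t : measurableTypeR R => nrm (step A v c t)).
Proof.
elim: n A v c => [|n IHn] A v c mA.
  rewrite (_ : (fun _ => _) = cst (nrm c)) ?measurable_cst//.
  by apply/funext => t; rewrite /step big_ord0 addr0.
set A' := fun i => A (lift ord0 i); set v' := fun i => v (lift ord0 i).
rewrite (_ : (fun _ => _) = (fun t => if t \in A ord0
    then nrm (step A' v' (c + v ord0) t) else nrm (step A' v' c t))); last first.
  by apply/funext => t; rewrite stepS; case: ifP.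
apply: measurable_fun_ifT; [|by apply: IHn => i; exact: mA..].
apply: (measurable_fun_bool true).
rewrite setTI (_ : _ @^-1` _ = A ord0)//.
by apply/seteqP; split=> t /=; [move/set_mem|move/mem_set].
Qed.

(** The sets may overlap, so the integral is not directly a sum of norms. By
    induction on their number: the first set cuts the domain in two, the first
    term is constant on both pieces, and the norm of the sum of the two
    integrals is at most the sum of their norms. *)
Lemma nrm_step_integral_le n (A : 'I_n -> set R) (v : 'I_n -> X) c (D : set R) :
  (forall i, measurable (A i : set (measurableTypeR R))) ->
  measurable (D : set (measurableTypeR R)) -> (mu D < +oo)%E ->
  ((nrm ((fine (mu D))%:C%C *: c +
         \sum_(i < n) (fine (mu (A i `&` D)))%:C%C *: v i))%:E <=
   \int[mu]_(t in D) (nrm (step A v c t))%:E)%E.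
Proof.
elim: n A v c D => [|n IHn] A v c D mA mD Doo.
  under eq_integral do rewrite /step big_ord0 addr0.
  rewrite integral_cst//= big_ord0 addr0 nrmZ ger0_norm ?fine_ge0//.
  by rewrite mulrC EFinM fineK// ge0_fin_numE.
set B := A ord0; have mB : measurable (B : set (measurableTypeR R)) := mA _.
set A' := fun i => A (lift ord0 i); set v' := fun i => v (lift ord0 i).
have mA' i : measurable (A' i : set (measurableTypeR R)) by exact: mA.
have mDB : measurable (D `&` B : set (measurableTypeR R)) by exact: measurableI.
have mDNB : measurable (D `\` B : set (measurableTypeR R)) by exact: measurableD.
have split_mu (E : set R) : measurable (E : set (measurableTypeR R)) ->
    fine (mu (E `&` D)) = fine (mu (E `&` (D `&` B))) + fine (mu (E `&` (D `\` B))).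
  move=> mE; have fin (F : set R) : measurable (F : set (measurableTypeR R)) ->
      mu (E `&` (D `&` F)) \is a fin_num.
    move=> mF; rewrite ge0_fin_numE//; apply: le_lt_trans Doo.
    by apply: le_measure; rewrite ?inE//; [do 2 apply: measurableI => //|move=> t [_ []]].
  rewrite -fineD; last 2 first.
  - exact: fin.
  - by rewrite setDE; apply: fin; exact: measurableC.
  congr fine; rewrite -measureU; first by rewrite -setIUr setUIDK.
  - exact: measurableI.
  - exact: measurableI.
  - by apply/seteqP; split=> // t /= [[_ [_ ?]] [_ []]].
rewrite [leRHS](_ : _ =
  (\int[mu]_(t in (D `&` B) `|` (D `\` B)) (nrm (step A v c t))%:E)%E); last first.
  by rewrite setUIDK.
rewrite ge0_integral_setU//; last 3 first.
- by rewrite setUIDK; apply/measurable_EFinP; apply: measurable_funTS;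
    exact: measurable_nrm_step.
- by move=> t _; rewrite lee_fin nrm_ge0.
- by apply/disj_setPS => t /= [[_ ?] [_ []]].
rewrite (eq_integral (fun t : measurableTypeR R =>
  (nrm (step A' v' (c + v ord0) t))%:E)); last first.
  by move=> t /set_mem[_ Bt]; rewrite stepS mem_set.
rewrite [X in (_ <= _ + X)%E](eq_integral (fun t : measurableTypeR R =>
  (nrm (step A' v' c t))%:E)); last first.
  by move=> t /set_mem[_ Bt]; rewrite stepS memNset.
have ltoo (E : set R) : measurable (E : set (measurableTypeR R)) -> E `<=` D -> (mu E < +oo)%E.
  by move=> mE ED; apply: le_lt_trans Doo; apply: le_measure; rewrite ?inE.
have := IHn A' v' (c + v ord0) (D `&` B) mA' mDB (ltoo _ mDB (@subIsetl _ _ _)).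
have := IHn A' v' c (D `\` B) mA' mDNB (ltoo _ mDNB (@subDsetl _ _ _)).
move=> h1 h2; apply: le_trans (leeD h2 h1); rewrite -EFinD lee_fin.
apply: le_trans (nrmD _ _); rewrite le_eqVlt; apply/orP; left; apply/eqP; congr nrm.
rewrite big_ord_recl -/B (setIC B).
rewrite -[in LHS](setTI D) split_mu// !setTI.
under [in LHS]eq_bigr do rewrite split_mu// rmorphD scalerDl.
rewrite big_split/= rmorphD/= scalerDl scalerDr -!addrA; congr (_ + _).
by rewrite [LHS]addrCA; congr (_ + _); rewrite [RHS]addrCA.
Qed.

Definition sf_sub (g h : @simple_function R X) : simple_function :=
  @SimpleFunction _ _ (sf_size g + sf_size h)%N
    (fun i => match fintype.split i with inl j => @sf_set _ _ g j | inr j => @sf_set _ _ h j end)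
    (fun i => match fintype.split i with inl j => @sf_val _ _ g j | inr j => - @sf_val _ _ h j end)
    (fun i => match fintype.split i as s return measurable
       (match s with inl j => @sf_set _ _ g j | inr j => @sf_set _ _ h j end
          : set (measurableTypeR R)) with
       | inl j => @sf_measurable _ _ g j | inr j => @sf_measurable _ _ h j end).

Lemma split_lshift m n (j : 'I_m) : fintype.split (lshift n j) = inl j.
Proof. exact: (unsplitK (inl j)). Qed.

Lemma split_rshift m n (j : 'I_n) : fintype.split (rshift m j) = inr j.
Proof. exact: (unsplitK (inr j)). Qed.

Lemma sf_evalB g h t : sf_eval (sf_sub g h) t = sf_eval g t - sf_eval h t.
Proof.
rewrite /sf_eval/= big_split_ord/= -sumrN; congr (_ + _).
  by apply: eq_bigr => j _; rewrite split_lshift.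
by apply: eq_bigr => j _; rewrite split_rshift scalerN.
Qed.

Lemma sf_integralB a b g h :
  sf_integral a b (sf_sub g h) = sf_integral a b g - sf_integral a b h.
Proof.
rewrite /sf_integral/= big_split_ord/= -sumrN; congr (_ + _).
  by apply: eq_bigr => j _; rewrite split_lshift.
by apply: eq_bigr => j _; rewrite split_rshift scalerN.
Qed.

Lemma sf_eval_step g t : sf_eval g t = step (@sf_set _ _ g) (@sf_val _ _ g) 0 t.
Proof. by rewrite /step add0r. Qed.

Lemma measurable_nrm_sf_eval (g : @simple_function R X) :
  measurable_fun setT (fun t : measurableTypeR R => nrm (sf_eval g t)).
Proof.
under eq_fun do rewrite sf_eval_step.
by apply: measurable_nrm_step => i; exact: sf_measurable.
Qed.

Lemma nrm_sf_integral_le a b (g : @simple_function R X) :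
  ((nrm (sf_integral a b g))%:E <= \int[mu]_(t in `[a, b]) (nrm (sf_eval g t))%:E)%E.
Proof.
under eq_integral do rewrite sf_eval_step.
have := @nrm_step_integral_le _ (@sf_set _ _ g) (@sf_val _ _ g) 0 `[a, b]%classic.
rewrite scaler0 add0r; apply => //; first exact: sf_measurable.
by rewrite /= lebesgue_measure_itv/=; case: ifP => // _; rewrite -EFinD ltry.
Qed.

End simple.

(** * Norm estimates for differences of Bochner integrals *)
Section bochner.
Context {R : realType} {X : completeNormedModType R[i]}.
Local Notation mu := (@lebesgue_measure R).
Implicit Types (u : R -> X) (v : X).

(** In general the norm is Borel measurable only after removing a null set, because simple
    functions converge to [u] only almost everywhere. *)
Lemma strongly_measurable_nrm_dist (D : set R) u :
  measurable (D : set (measurableTypeR R)) -> strongly_measurable D u ->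
  exists N : set R, [/\ measurable (N : set (measurableTypeR R)), mu N = 0 &
    forall g : @simple_function R X,
      measurable_fun (D `\` N) (fun t : measurableTypeR R => nrm (u t - sf_eval g t))].
Proof.
move=> mD [g [N [mN muN gN]]]; exists N; split=> // h.
apply: (@measurable_fun_cvg _ _ _ _ (fun n t => nrm (sf_eval (g n) t - sf_eval h t))).
- move=> n; apply: measurable_funTS.
  under eq_fun do rewrite -sf_evalB.
  exact: measurable_nrm_sf_eval.
- move=> t [Dt Nt]; apply: cvg_nrm; apply: cvgB; last exact: cvg_cst.
  by apply: contrapT => ut; apply: Nt; apply: gN => /(_ Dt).
Qed.

(** For the approximating simple functions g1, g2 one has
    |g1 - g2| <= G + |u1 - g1| + |u2 - g2| outside a null set; the last two
    integrals tend to 0 by definition of the Bochner integral.  Treating both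
    integrals at once avoids additivity of the Bochner integral, which
    would need the same argument. *)
Lemma bochner_dist_le (a b : R) u1 u2 v1 v2 (G : R -> R) :
  is_bochner_integral a b u1 v1 -> is_bochner_integral a b u2 v2 ->
  measurable_fun setT (G : measurableTypeR R -> R) -> (forall t, 0 <= G t) ->
  {ae mu, forall t, `[a, b]%classic t -> nrm (u1 t - u2 t) <= G t} ->
  ((nrm (v1 - v2))%:E <= \int[mu]_(t in `[a, b]) (G t)%:E)%E.
Proof.
move=> [mu1 [g1 [ug1 gv1]]] [mu2 [g2 [ug2 gv2]]] mG G0 [N3 [mN3 N30 uG]].
set D := `[a, b]%classic.
have mD : measurable (D : set (measurableTypeR R)) := measurable_itv _.
have [N1 [mN1 N10 h1]] := strongly_measurable_nrm_dist mD mu1.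
have [N2 [mN2 N20 h2]] := strongly_measurable_nrm_dist mD mu2.
pose N := N1 `|` N2 `|` N3.
have mN12 : measurable (N1 `|` N2 : set (measurableTypeR R)) by exact: measurableU.
have mN : measurable (N : set (measurableTypeR R)) by exact: measurableU.
have N0 : mu N = 0.
  by rewrite /N !measureU0.
have mDN : measurable (D `\` N : set (measurableTypeR R)) by exact: measurableD.
pose d1 n (t : measurableTypeR R) := (nrm (u1 t - sf_eval (g1 n) t))%:E.
pose d2 n (t : measurableTypeR R) := (nrm (u2 t - sf_eval (g2 n) t))%:E.
have d10 n t : (0 <= d1 n t)%E by rewrite lee_fin nrm_ge0.
have d20 n t : (0 <= d2 n t)%E by rewrite lee_fin nrm_ge0.
have GE0 t : (0 <= (G t)%:E)%E by rewrite lee_fin.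
have md1 n : measurable_fun (D `\` N) (d1 n).
  apply/measurable_EFinP; apply: measurable_funS (h1 _); first exact: measurableD.
  by move=> t [Dt Nt]; split=> // ?; apply: Nt; left; left.
have md2 n : measurable_fun (D `\` N) (d2 n).
  apply/measurable_EFinP; apply: measurable_funS (h2 _); first exact: measurableD.
  by move=> t [Dt Nt]; split=> // ?; apply: Nt; left; right.
have mGE : measurable_fun (D `\` N) (fun t : measurableTypeR R => (G t)%:E).
  by apply/measurable_EFinP; exact: measurable_funTS.
have key n : ((nrm (sf_integral a b (g1 n) - sf_integral a b (g2 n)))%:E <=
    \int[mu]_(t in D) (G t)%:E + (\int[mu]_(t in D) d1 n t + \int[mu]_(t in D) d2 n t))%E.
  (* outside N all three functions on the right-hand side are Borel *)
  rewrite -sf_integralB; apply: le_trans (nrm_sf_integral_le _ _ _) _.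
  have mg : measurable_fun D
      (fun t : measurableTypeR R => (nrm (sf_eval (sf_sub (g1 n) (g2 n)) t))%:E).
    by apply/measurable_EFinP; apply: measurable_funTS; exact: measurable_nrm_sf_eval.
  rewrite (ge0_negligible_integral mN)//; last by move=> t _; rewrite lee_fin nrm_ge0.
  apply: (@le_trans _ _ (\int[mu]_(t in D `\` N) ((G t)%:E + (d1 n t + d2 n t)))%E).
    apply: ge0_le_integral => //.
    - by move=> t _; rewrite lee_fin nrm_ge0.
    - by apply: measurable_funS mg => // t [].
    - exact: (emeasurable_funD mGE (emeasurable_funD (md1 n) (md2 n))).
    - move=> t [Dt Nt]; rewrite sf_evalB -!EFinD lee_fin.
      have uGt : nrm (u1 t - u2 t) <= G t.
        by apply: contrapT => uGt; apply: Nt; right; apply: uG => /(_ Dt).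
      rewrite (_ : _ - _ = (u1 t - u2 t) -
        ((u1 t - sf_eval (g1 n) t) - (u2 t - sf_eval (g2 n) t))); last first.
        by rewrite -[LHS](subKr (u1 t - u2 t)); congr (_ - _); rewrite !opprD !opprK addrACA.
      by apply: le_trans (nrmB _ _) _; rewrite lerD// (le_trans (nrmB _ _)).
  rewrite ge0_integralD//; last 2 first.
  - by move=> t _; rewrite adde_ge0.
  - exact: (emeasurable_funD (md1 n) (md2 n)).
  rewrite (ge0_integralD _ mDN _ (md1 n) _ (md2 n))//.
  by apply: leeD; [|apply: leeD]; apply: ge0_le_lower_integral => // t [].
have c1 : (nrm (sf_integral a b (g1 n) - sf_integral a b (g2 n)))%:E @[n --> \oo]
    --> (nrm (v1 - v2))%:E.
  by apply: cvg_EFin; [exact: nearW|apply: cvg_nrm; exact: cvgB].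
have c2 : (\int[mu]_(t in D) (G t)%:E +
    (\int[mu]_(t in D) d1 n t + \int[mu]_(t in D) d2 n t))%E @[n --> \oo]
    --> (\int[mu]_(t in D) (G t)%:E + (0 + 0))%E.
  apply: cvgeD; [by rewrite ?adde0 fin_num_adde_defl| exact: cvg_cst |].
  exact: cvgeD.
by rewrite -[leRHS]adde0 -[X in (_ <= _ + X)%E]adde0; exact: (lee_cvg_to c1 c2 (nearW _ key)).
Qed.

Lemma integral_expR_le (c m s t : R) : 0 <= c -> 0 < m -> s <= t ->
  (\int[mu]_(r in `[s, t]) (c * expR (- m * (t - r)))%:E <= (c / m)%:E)%E.
Proof.
move=> c0 m0; rewrite le_eqVlt => /predU1P[->|st].
  by rewrite set_itv1 integral_set1 lee_fin divr_ge0// ltW.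
pose F r := c / m * expR (- m * (t - r)).
have dF (r : R) : is_derive r (1 : R) F (c * expR (- m * (t - r))).
  rewrite /F; apply: is_derive_eq; rewrite /GRing.scale/=.
  by field; rewrite gt_eqF.
have cexp : continuous (fun r => c * expR (- m * (t - r))).
  move=> r; apply: cvgM; first exact: cvg_cst.
  apply: continuous_comp; last exact: continuous_expR.
  apply: cvgM; first exact: cvg_cst.
  by apply: cvgB; [exact: cvg_cst|exact: cvg_id].
have cF : continuous F.
  by move=> r; apply: differentiable_continuous; apply/derivable1_diffP; exact: ex_derive.
rewrite (@continuous_FTC2 _ _ F)//.
- rewrite -EFinB lee_fin /F subrr mulr0 expR0 mulr1 gerBl.
  by rewrite mulr_ge0 ?expR_ge0// divr_ge0// ltW.
- exact: continuous_subspaceT.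
- split=> [r _||]; [exact: ex_derive| |].
  + by apply: cvg_at_right_filter; exact: cF.
  + by apply: cvg_at_left_filter; exact: cF.
- by move=> r _; rewrite derive1E derive_val.
Qed.

End bochner.

Section bochner_exp.
Context {R : realType} {X : completeNormedModType R[i]}.
Local Notation mu := (@lebesgue_measure R).
Implicit Types (u : R -> X) (v : X).

Lemma bochner_dist_le_expR (c m s t : R) u1 u2 v1 v2 : 0 <= c -> 0 < m -> s <= t ->
  is_bochner_integral s t u1 v1 -> is_bochner_integral s t u2 v2 ->
  {ae mu, forall r, `[s, t]%classic r ->
    nrm (u1 r - u2 r) <= c * expR (- m * (t - r))} ->
  nrm (v1 - v2) <= c / m.
Proof.
move=> c0 m0 st u1v1 u2v2 u12; rewrite -lee_fin.
apply: le_trans (integral_expR_le c0 m0 st).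
apply: bochner_dist_le u1v1 u2v2 _ _ u12 => [|r]; last by rewrite mulr_ge0 ?expR_ge0.
apply: continuous_measurable_fun => r; apply: cvgM; first exact: cvg_cst.
apply: continuous_comp; last exact: continuous_expR.
apply: cvgM; first exact: cvg_cst.
by apply: cvgB; [exact: cvg_cst|exact: cvg_id].
Qed.

Lemma is_bochner_integral0 (a b : R) : is_bochner_integral a b (fun=> 0 : X) 0.
Proof.
pose z : @simple_function R X :=
  @SimpleFunction _ _ 0 (fun=> set0) (fun=> 0) (fun=> measurable0).
have z0 t : sf_eval z t = 0 by rewrite /sf_eval big_ord0.
split; exists (fun=> z).
  by apply: aeW => t _ /=; rewrite z0; exact: cvg_cst.
split; last by rewrite /sf_integral big_ord0; exact: cvg_cst.
rewrite /= integral0_eq; first exact: cvg_cst.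
by move=> t _; rewrite z0 subrr nrm0.
Qed.

(** Rescale [x] to the unit sphere. *)
Lemma opnorm_le (T : X -> X) (c : R) (x : X) : linear T -> (opnorm T <= c%:E)%E ->
  nrm (T x) <= c * nrm x.
Proof.
move=> linT Tc.
have T0 : T 0 = 0 by have := linT (-1) 0 0; rewrite scaler0 addr0 scaleN1r addNr.
have [x0|x0] := eqVneq (nrm x) 0.
  by rewrite x0 mulr0 (nrm_eq0 x0) T0 nrm0.
have x_gt0 : 0 < nrm x by rewrite lt_neqAle eq_sym x0 nrm_ge0.
have TZ (k : R[i]) y : T (k *: y) = k *: T y.
  by rewrite -[k *: y]addr0 linT T0 addr0.
have : ((nrm (T (((nrm x)^-1)%:C%C *: x)))%:E <= c%:E)%E.
  apply: le_trans Tc; apply: ereal_sup_ubound; exists (((nrm x)^-1)%:C%C *: x) => //=.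
  by rewrite nrmZ ger0_norm ?invr_ge0 ?nrm_ge0// mulVf.
by rewrite TZ lee_fin nrmZ ger0_norm ?invr_ge0 ?nrm_ge0// mulrC ler_pdivrMr.
Qed.

End bochner_exp.

(** * Contraction of Duhamel solutions in an exponentially weighted norm *)
Section stability.
Context {R : realType} {X : completeNormedModType R[i]}.
Context (U : R -> R -> X -> X) (f : R -> X -> X) (K lambda : R).
Context (U_linear : forall t s, s <= t -> linear (U t s)).
Context (U_exp : forall t s, s <= t ->
  (opnorm (U t s) <= (K * expR (- lambda * (t - s)))%:E)%E).
Context (K_ge0 : 0 <= K).
Local Notation mu := (@lebesgue_measure R).

Lemma evolution_le t s z : s <= t ->
  nrm (U t s z) <= K * expR (- lambda * (t - s)) * nrm z.
Proof. by move=> st; apply: opnorm_le; [exact: U_linear|exact: U_exp]. Qed.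

Lemma evolutionB t s y z : s <= t -> U t s (y - z) = U t s y - U t s z.
Proof.
move=> st; have := U_linear st (-1) z y.
by rewrite !scaleN1r [- z + y]addrC [- _ + _]addrC.
Qed.

(** One step of the contraction: the product of the decay of [U] and of the
    weight is e^(-kappa (t - t0)) e^(-(lambda - kappa) (t - r)), whose second
    factor integrates to at most 1 / (lambda - kappa). *)
Lemma duhamel_dist_le (Lf kappa m t0 t : R) (x y : R -> X) :
  (forall r y z, nrm (f r y - f r z) <= Lf * nrm (y - z)) ->
  0 <= Lf -> kappa < lambda -> 0 <= m -> t0 <= t ->
  duhamel U f x t t0 -> duhamel U f y t t0 ->
  (forall r, t0 <= r <= t -> nrm (x r - y r) <= m * expR (- kappa * (r - t0))) ->
  nrm (x t - y t) <=
  (K * nrm (x t0 - y t0) + K * Lf / (lambda - kappa) * m) * expR (- kappa * (t - t0)).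
Proof.
move=> f_lip Lf0 kl m0 t0t [v1 xv1 ->] [v2 yv2 ->] xy.
rewrite opprD addrACA -evolutionB//; apply: le_trans (nrmD _ _) _; rewrite mulrDl lerD//.
  apply: le_trans (evolution_le _ t0t) _.
  rewrite mulrAC ler_wpM2l ?mulr_ge0 ?nrm_ge0// ler_expR ler_wpM2r ?subr_ge0//.
  by rewrite lerN2 ltW.
have lk0 : 0 < lambda - kappa by rewrite subr_gt0.
rewrite [leRHS](_ : _ = (K * Lf * m * expR (- kappa * (t - t0))) / (lambda - kappa)).
  2: by field; rewrite gt_eqF.
apply: bochner_dist_le_expR t0t xv1 yv2 _ => //.
  by rewrite !mulr_ge0 ?expR_ge0.
apply: aeW => r; rewrite /= in_itv/= => /andP[t0r rt].
rewrite -evolutionB//; apply: le_trans (evolution_le _ rt) _.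
apply: (@le_trans _ _ (K * expR (- lambda * (t - r)) *
    (Lf * (m * expR (- kappa * (r - t0)))))).
  rewrite ler_wpM2l ?mulr_ge0 ?expR_ge0//; apply: le_trans (f_lip _ _ _) _.
  by rewrite ler_wpM2l// xy// t0r.
rewrite le_eqVlt; apply/orP; left; apply/eqP.
transitivity (K * Lf * m * (expR (- lambda * (t - r)) * expR (- kappa * (r - t0)))).
  by ring.
rewrite -expRD -[RHS]mulrA -expRD; congr (_ * expR _); ring.
Qed.

(** The least constant [m] valid in [duhamel_dist_le] on the whole of [t0, t] is
    finite because the distance is bounded, and the step turns it into
    m <= K w(t0) + q m with q < 1. *)
Lemma duhamel_dist_expR (Lf kappa B t0 t : R) (x y : R -> X) :
  (forall r y z, nrm (f r y - f r z) <= Lf * nrm (y - z)) ->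
  0 <= Lf -> 0 <= kappa -> K * Lf < lambda - kappa -> t0 <= t ->
  (forall r, t0 <= r <= t -> duhamel U f x r t0) ->
  (forall r, t0 <= r <= t -> duhamel U f y r t0) ->
  (forall r, t0 <= r <= t -> nrm (x r - y r) <= B) ->
  nrm (x t - y t) <=
  K / (1 - K * Lf / (lambda - kappa)) * nrm (x t0 - y t0) * expR (- kappa * (t - t0)).
Proof.
move=> f_lip Lf0 k0 KLf t0t dx dy xyB.
have lk0 : 0 < lambda - kappa by apply: le_lt_trans KLf; rewrite mulr_ge0.
set q := K * Lf / (lambda - kappa).
have q1 : q < 1 by rewrite ltr_pdivrMr// mul1r.
have expK r : expR (- kappa * (r - t0)) * expR (kappa * (r - t0)) = 1.
  by rewrite -expRD -mulrDl addNr mul0r expR0.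
pose S := [set nrm (x r - y r) * expR (kappa * (r - t0)) | r in `[t0, t]%classic].
have S_sup : has_sup S.
  split; first by exists (nrm (x t0 - y t0) * expR (kappa * (t0 - t0))), t0 => //=;
    rewrite in_itv/= lexx.
  exists (B * expR (kappa * (t - t0))) => _ [r /= rt <-]; move: rt; rewrite in_itv/= => rt.
  apply: ler_pM; rewrite ?nrm_ge0 ?expR_ge0 ?xyB//.
  by rewrite ler_expR ler_wpM2l// lerD2r; case/andP: rt.
have S_ub r : t0 <= r <= t -> nrm (x r - y r) * expR (kappa * (r - t0)) <= sup S.
  by move=> rt; apply: ub_le_sup; [exact: S_sup.2|exists r => //=; rewrite in_itv/=].
have S0 : 0 <= sup S.
  by apply: le_trans (S_ub t0 _); rewrite ?lexx// mulr_ge0 ?nrm_ge0 ?expR_ge0.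
have dist_sup r : t0 <= r <= t -> nrm (x r - y r) <= sup S * expR (- kappa * (r - t0)).
  move=> rt; rewrite -[leLHS]mulr1 -(expK r) [_ * expR (kappa * _)]mulrC mulrA.
  by rewrite ler_wpM2r ?expR_ge0// S_ub.
have supS : sup S <= K * nrm (x t0 - y t0) + q * sup S.
  apply: ge_sup => [|_ [r /= rt <-]]; first exact: S_sup.1.
  move: rt; rewrite in_itv/= => /andP[t0r rt].
  rewrite -[leRHS]mulr1 -(expK r) mulrA ler_wpM2r ?expR_ge0//.
  apply: duhamel_dist_le => //.
  - by rewrite -subr_gt0.
  - by apply: dx; rewrite t0r.
  - by apply: dy; rewrite t0r.
  - by move=> r' /andP[t0r' r'r]; apply: dist_sup; rewrite t0r'/= (le_trans r'r).
apply: (le_trans (dist_sup t _)); first by rewrite t0t lexx.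
rewrite ler_wpM2r ?expR_ge0// mulrAC ler_pdivlMr ?subr_gt0//.
by rewrite mulrBr mulr1 lerBlDr [sup S * q]mulrC.
Qed.

(** The Duhamel formula from a time [s] with ||y(s)|| <= M, M an essential bound
    of [y], bounds y(t) by a constant that does not depend on [s] and [t]. *)
Lemma mild_solution_bounded (Mf : R) (y : R -> X) :
  0 < lambda -> 0 <= Mf -> (forall t z, nrm (f t z) <= Mf * (1 + nrm z)) ->
  mild_solution U f y -> exists B, forall t, nrm (y t) <= B.
Proof.
move=> l0 Mf0 f_growth [[_ y_ess] y_duhamel].
have [M yM] : exists M : R, {ae mu, forall t, nrm (y t) <= M}.
  have := ess_sup_ge mu (fun t => (nrm (y t))%:E).
  move: y_ess; case: ess_sup => [r _ h|//|_ h].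
  - by exists r; apply: filterS h => t; rewrite lee_fin.
  - by exists 0; apply: filterS h => t; rewrite leNgt ltNyr.
exists (K * M + K * Mf * (1 + M) / lambda) => t.
(* [t - 1, t] has positive measure, so it is not inside an exceptional null set *)
have [s [st ys]] : exists s, s <= t /\ nrm (y s) <= M.
  apply: contrapT => /forallNP noS; have [N [mN N0 subN]] := yM.
  have tN : `[t - 1, t]%classic `<=` N.
    move=> s /=; rewrite in_itv/= => /andP[_ st]; apply: subN => /= ysM.
    by apply: (noS s).
  have : (mu `[(t - 1)%R, t]%classic <= 0)%E.
    by rewrite -N0; apply: le_measure; rewrite ?inE.
  rewrite lebesgue_measure_itv/= lte_fin ltrBlDr ltrDl ltr01 -EFinB lee_fin.
  by rewrite opprB addrC subrK ler10.
have M0 : 0 <= M by apply: le_trans ys; exact: nrm_ge0.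
have [v yv ->] := y_duhamel t s st.
apply: le_trans (nrmD _ _) _; apply: lerD.
  apply: le_trans (evolution_le _ st) _; apply: ler_pM; rewrite ?mulr_ge0 ?nrm_ge0 ?expR_ge0//.
  by rewrite -[leRHS]mulr1 ler_wpM2l// -expR0 ler_expR nmulr_rle0 ?subr_ge0// oppr_lt0.
rewrite -[v]subr0; apply: bochner_dist_le_expR l0 st yv (is_bochner_integral0 _ _) _.
  by rewrite !mulr_ge0// addr_ge0.
have [N [mN N0 yN]] := yM; exists N; split=> // r /= nr; apply: yN => /= yrM; apply: nr.
rewrite in_itv/= subr0 => /andP[_ rt].
apply: le_trans (evolution_le _ rt) _; rewrite mulrAC -!mulrA.
rewrite ler_wpM2l// [leRHS]mulrA ler_wpM2r ?expR_ge0//.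
by apply: le_trans (f_growth _ _) _; rewrite ler_wpM2l// lerD2l.
Qed.

End stability.

(** * Uniqueness and global exponential stability *)
Section local_bound.
Context {R : realType} {X : completeNormedModType R[i]}.

Lemma within_continuous_bounded (x : R -> X) (a b : R) : a <= b ->
  {within `[a, b], continuous x} -> exists B, forall r, a <= r <= b -> nrm (x r) <= B.
Proof.
move=> ab cx; have cnx : {within `[a, b], continuous (fun r => nrm (x r))}.
  by move=> r; exact: cvg_nrm (cx r).
have [c _ maxc] := EVT_max ab cnx; exists (nrm (x c)) => r rab.
by apply: maxc; rewrite in_itv.
Qed.

End local_bound.

Theorem theorem5p1 (R : realType) (X : completeNormedModType R[i]) (p : R)
    (A : R -> @partial_op R X) (U : R -> R -> X -> X) (f : R -> X -> X)
    (K lambda Lf Mf : R)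
    (p_ge1 : 1 <= p)
    (A_linear : forall t, linear_op (A t))
    (A_closed : forall t, closed_op (A t))
    (A_dense : forall t, densely_defined (A t))
    (A_AT : acquistapace_terreni A)
    (U_evol : evolution_family A U)
    (K_ge1 : 1 <= K) (lambda_gt0 : 0 < lambda)
    (U_exp : forall t s, s <= t ->
       (opnorm (U t s) <= (K * expR (- lambda * (t - s)))%:E)%E)
    (U_biAA : bi_almost_automorphic U)
    (f_WAA : W_AA2 p f)
    (Lf_gt0 : 0 < Lf) (Mf_gt0 : 0 < Mf)
    (f_lip : forall t x y, nrm (f t x - f t y) <= Lf * nrm (x - y))
    (f_growth : forall t x, nrm (f t x) <= Mf * (1 + nrm x))
    (Theta_lt1 : K * Lf / lambda < 1) :
  forall xs : R -> X, mild_solution U f xs -> W_AA p xs ->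
    (forall y : R -> X, mild_solution U f y -> W_AA p y -> y = xs) /\
    globally_exponentially_stable U f xs.
Proof.
have U_linear t s : s <= t -> linear (U t s).
  by move=> st; case: U_evol => -[bU _] _ _ _ _; case: (bU t s st).
have K_ge0 : 0 <= K by apply: le_trans K_ge1; exact: ler01.
have KLf_lt : K * Lf < lambda by rewrite ltr_pdivrMr ?mul1r in Theta_lt1.
have KLf_ge0 : 0 <= K * Lf by rewrite mulr_ge0// ltW.
(* half of the gap goes to the decay rate, half to the contraction *)
pose kappa := (lambda - K * Lf) / 2.
have kappa_gt0 : 0 < kappa by rewrite divr_gt0 ?subr_gt0.
have KLf_lk : K * Lf < lambda - kappa by rewrite /kappa; lra.
have lk_gt0 : 0 < lambda - kappa by apply: le_lt_trans KLf_lk.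
pose N := K / (1 - K * Lf / (lambda - kappa)).
have N_gt0 : 0 < N.
  by rewrite divr_gt0 ?(lt_le_trans ltr01 K_ge1)// subr_gt0 ltr_pdivrMr// mul1r.
move=> xs xs_mild _.
have bounded := mild_solution_bounded U_linear U_exp K_ge0 lambda_gt0 (ltW Mf_gt0) f_growth.
have [Bs xsB] := bounded _ xs_mild.
split=> [y y_mild _|].
  have [By yB] := bounded _ y_mild.
  apply/funext => t; apply/eqP; rewrite -subr_eq0; apply/eqP/nrm_eq0/eqP.
  have distB r : nrm (y r - xs r) <= By + Bs.
    by apply: le_trans (nrmB _ _) _; rewrite lerD.
  have B_ge0 : 0 <= By + Bs by apply: le_trans (distB t); exact: nrm_ge0.
  rewrite eq_le nrm_ge0 andbT leNgt; apply/negP => w_gt0.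
  set w := nrm _ in w_gt0.
  (* large enough for w e^(kappa T) >= w (1 + kappa T) > N (By + Bs) *)
  pose T := N * (By + Bs) / (kappa * w).
  have T_ge0 : 0 <= T by apply: divr_ge0; apply: mulr_ge0 => //; exact: ltW.
  have tT : t - T <= t by rewrite gerBl.
  have : w <= N * (By + Bs) * expR (- kappa * (t - (t - T))).
    apply: (@le_trans _ _ (N * nrm (y (t - T) - xs (t - T)) *
        expR (- kappa * (t - (t - T))))).
      apply: (@duhamel_dist_expR _ _ U f K lambda U_linear U_exp K_ge0 Lf _ (By + Bs)) => //.
      - exact: ltW.
      - exact: ltW.
      - by move=> r /andP[? _]; exact: y_mild.2.
      - by move=> r /andP[? _]; exact: xs_mild.2.
    by rewrite ler_wpM2r ?expR_ge0// ler_wpM2l ?distB// ltW.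
  rewrite subKr mulNr expRN ler_pdivlMr ?expR_gt0//.
  apply/negP; rewrite -ltNge.
  apply: (@lt_le_trans _ _ (w * (1 + kappa * T))); last first.
    by rewrite ler_wpM2l ?expR_ge1Dx// ltW.
  rewrite (_ : w * _ = w + N * (By + Bs)) ?ltrDr//.
  by rewrite /T; field; rewrite !gt_eqF.
exists N, kappa; split=> // t0 x cx dx t t0t.
have [Bx xB] : exists B, forall r, t0 <= r <= t -> nrm (x r) <= B.
  apply: within_continuous_bounded; first exact: ltW.
  by apply: continuous_subspaceW cx; exact: subset_itvl.
apply: (@duhamel_dist_expR _ _ U f K lambda U_linear U_exp K_ge0 Lf _ (Bx + Bs)) => //.
- exact: ltW.
- exact: ltW.
- exact: ltW.
- by move=> r /andP[? _]; exact: dx.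
- by move=> r /andP[? _]; exact: xs_mild.2.
- by move=> r rt; apply: le_trans (nrmB _ _) _; rewrite lerD// xB.
Qed.
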